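(* Let $n\ge 0$ and $j\ge 0$ be integers. The number of partitions $\pi$ into distinct parts with $\mathcal{E}(\pi)=n$ and $\gamma(\pi)=j$ equals the number of partitions of $n$ into parts $\le j$.
   Context: A partition $\pi=(\lambda_1,\lambda_2,\dots)$ is a finite non-increasing sequence of positive integers; the empty sequence is the unique partition of $0$. $\mathcal{E}(\pi)=\lambda_2+\lambda_4+\lambda_6+\cdots$ is the sum of the even-indexed parts, and $\gamma(\pi)=\lambda_1-\lambda_2+\lambda_3-\lambda_4+\cdots$ is the alternating sum of parts. *)

(* Defs.v *)
From mathcomp Require Import all_boot all_order all_algebra.
From mathcomp Require Import finmap.
From mathcomp Require Import classical_sets cardinality.

Set Implicit Arguments.
Unset Strict Implicit.
Unset Printing Implicit Defensive.

Definition is_partition (s : seq nat) : bool :=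
  sorted geq s && all (leq 1) s.

(* Sequences are indexed from 0, so the part lambda_(i+1) is
   [nth 0 s i], and the even-indexed parts are those with [i] odd. *)
Definition even_index_sum (s : seq nat) : nat :=
  \sum_(i < size s | odd i) nth 0 s i.

(* Taken in [int] so that no subtraction is truncated. *)
Definition alternating_sum (s : seq nat) : int :=
  (\sum_(i < size s) (-1) ^+ i * (nth 0%N s i)%:Z)%R.

Definition distinct_partitions (n j : nat) : set (seq nat) :=
  [set s | [/\ is_partition s, uniq s,
               even_index_sum s = n & alternating_sum s = (j%:Z)%R]]%classic.

Definition bounded_partitions (n j : nat) : set (seq nat) :=
  [set s | [/\ is_partition s, sumn s = n & all (fun p => p <= j) s]]%classic.

(* Main.v *)
Require Import Defs.
From mathcomp Require Import all_boot all_order all_algebra.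
From mathcomp Require Import finmap.
From mathcomp Require Import classical_sets cardinality.
From mathcomp Require Import zify ring.

(** Read two parts at a time from the left, Sylvester's fishhook bijection is a
    recursion.  For a partition lambda = (x, y, rho) into distinct parts, nu is
    obtained from the image of rho by adding 1 to each of its parts, padding
    with parts equal to 1, and putting gamma(rho) + 1 in front; the padding is
    chosen so that nu has y - gamma(rho) parts.  Thus the pair (x, y) accounts
    for the first row and first column of the Young diagram of nu, a hook of
    size y.  The recursion is driven by the invariant
    lambda_1 = gamma(lambda) + length(nu). *)

Lemma seq_pair_ind (T : Type) (P : seq T -> Prop) :
  P [::] -> (forall x, P [:: x]) ->
  (forall x y s, P s -> P [:: x, y & s]) -> forall s, P s.
Proof.
move=> P0 P1 P2; fix IH 1 => -[|x [|y s]]; [exact: P0 | exact: P1 |].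
exact: P2.
Qed.

Lemma is_partition_cons (x : nat) (s : seq nat) :
  is_partition (x :: s) = [&& 0 < x, head 0 s <= x & is_partition s].
Proof.
rewrite /is_partition /=; case: s => [|y s] /=; first by rewrite !andbT.
by case: (0 < x); case: (y <= x); rewrite /= ?andbF ?andbT.
Qed.

Lemma is_partition_pairwise (s : seq nat) :
  is_partition s = pairwise geq s && all (leq 1) s.
Proof.
by rewrite /is_partition sorted_pairwise // => a b c /= ba ca; exact: leq_trans ba.
Qed.

Lemma is_partition_all_head (x : nat) (s : seq nat) :
  is_partition (x :: s) -> all (geq x) s.
Proof. by rewrite is_partition_pairwise /= => /andP[/andP[]]. Qed.

(** Distinctness is built into the ordering, so that it can be peeled off one part at a time. *)
Definition is_strict_partition (s : seq nat) : bool :=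
  sorted gtn s && all (leq 1) s.

Lemma is_strict_partitionE (s : seq nat) :
  is_strict_partition s = is_partition s && uniq s.
Proof.
by rewrite /is_strict_partition /is_partition gtn_sorted_uniq_geq -andbA andbC.
Qed.

Lemma is_strict_partition_cons (x : nat) (s : seq nat) :
  is_strict_partition (x :: s) = (head 0 s < x) && is_strict_partition s.
Proof.
rewrite /is_strict_partition /=; case: s => [|y s] /=; first by rewrite !andbT.
by rewrite -!andbA; case: (ltnP y x) => //= yx; rewrite (leq_ltn_trans _ yx).
Qed.

(* On non-increasing sequences the truncated subtraction is exact. *)
Fixpoint gamma (s : seq nat) : nat :=
  if s is x :: s' then (if s' is y :: t then x - y + gamma t else x) else 0.

Lemma alternating_sum_cons (x : nat) (s : seq nat) :
  alternating_sum (x :: s) = (x%:Z - alternating_sum s)%R.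
Proof.
rewrite /alternating_sum big_ord_recl /= GRing.expr0 GRing.mul1r; congr (_ + _)%R.
by rewrite -GRing.sumrN; apply: eq_bigr => i _; rewrite GRing.exprS; ring.
Qed.

Lemma alternating_sumE (s : seq nat) :
  sorted geq s -> alternating_sum s = (gamma s)%:Z%R.
Proof.
elim/seq_pair_ind: s => [_|x _|x y s IH /= /andP[yx /path_sorted ss]].
- by rewrite /alternating_sum big_ord0.
- by rewrite alternating_sum_cons /alternating_sum big_ord0 GRing.subr0.
- by rewrite !alternating_sum_cons IH //; lia.
Qed.

Lemma even_index_sum_cons2 (x y : nat) (s : seq nat) :
  even_index_sum [:: x, y & s] = y + even_index_sum s.
Proof.
rewrite /even_index_sum big_mkcond !big_ord_recl /= add0n; congr (_ + _).
by rewrite [RHS]big_mkcond; apply: eq_bigr => i _ /=; rewrite negbK.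
Qed.

(** On strict partitions the padding length is not truncated: by the invariant it is
    [y - 1 - head 0 t]. A lone part is recorded by [gamma] alone. *)
Fixpoint sylvester (s : seq nat) : seq nat :=
  if s is _ :: s' then
    (if s' is y :: t then
       (gamma t).+1 :: [seq p.+1 | p <- sylvester t]
         ++ nseq (y - (gamma t).+1 - size (sylvester t)) 1
     else [::])
  else [::].

(** The new image has [y - gamma t] parts while [gamma] becomes [x - y + gamma t], so the two add up
    to [x]. *)
Lemma size_sylvester (s : seq nat) :
  is_strict_partition s -> gamma s + size (sylvester s) = head 0 s.
Proof.
elim/seq_pair_ind: s => [//|x _|x y s IH]; first by rewrite /= addn0.
rewrite !is_strict_partition_cons => /and3P[/= yx sy /IH E].
by rewrite size_cat size_map size_nseq; lia.
Qed.

(** Since [y < x], the front part [gamma t + 1] is at most [x - y + gamma t]; by induction it bounds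
    the raised parts. *)
Lemma sylvester_le_gamma (s : seq nat) :
  is_strict_partition s -> all (geq (gamma s)) (sylvester s).
Proof.
elim/seq_pair_ind: s => [//|//|x y s IH].
rewrite !is_strict_partition_cons => /and3P[/= yx sy /IH E].
apply/andP; split; first lia.
rewrite all_cat all_map all_nseq; apply/andP; split; last by rewrite /=; lia.
by apply: sub_all E => p /=; lia.
Qed.

Lemma is_partition_sylvester (s : seq nat) :
  is_strict_partition s -> is_partition (sylvester s).
Proof.
elim/seq_pair_ind: s => [//|//|x y s IH].
rewrite !is_strict_partition_cons => /and3P[/= yx sy ss].
have := sylvester_le_gamma s ss; move: (IH ss); rewrite !is_partition_pairwise /=.
move=> /andP[pw pos] le_g; rewrite pairwise_cat pairwise_map !all_cat !all_map.
rewrite !all_nseq pw /= !orbT !andbT; rewrite -!andbA; apply/and4P; split.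
- exact: sub_all le_g.
- by apply/allrelP => _ _ /mapP[p _ ->] /nseqP[-> _].
- by elim: (_ - size _) => //= k ->; rewrite all_nseq orbT.
- by apply/allP.
Qed.

Lemma sumn_map_succ (s : seq nat) : sumn [seq p.+1 | p <- s] = sumn s + size s.
Proof. by elim: s => //= x s ->; lia. Qed.

(** The front part, the units added to the old parts and the padding together make up the hook size
    [y]. *)
Lemma sumn_sylvester (s : seq nat) :
  is_strict_partition s -> sumn (sylvester s) = even_index_sum s.
Proof.
elim/seq_pair_ind: s => [_|x _|x y s IH].
- by rewrite /even_index_sum big_ord0.
- by rewrite /even_index_sum big_mkcond big_ord_recl big_ord0.
rewrite !is_strict_partition_cons => /and3P[/= yx sy ss].
rewrite even_index_sum_cons2 -IH // sumn_cat sumn_nseq sumn_map_succ.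
by have := size_sylvester s ss; lia.
Qed.

(** Removes the first column of the Young diagram; on the tail of an image it undoes the raising and
    the padding. *)
Definition shrink (s : seq nat) : seq nat := [seq p.-1 | p <- s & 1 < p].

Lemma shrinkK (s : seq nat) : is_partition s ->
  [seq p.+1 | p <- shrink s] ++ nseq (size s - size (shrink s)) 1 = s.
Proof.
rewrite /shrink; elim: s => [//|x s IH] ps; have := ps.
rewrite is_partition_cons => /and3P[x0 _ /IH E] /=.
case: ltnP => [x1|x1] /=; first by rewrite prednK // subSS E.
(* The head is at most 1 and bounds the tail, so nothing survives the filter. *)
have ->: [seq p <- s | 1 < p] = [::].
  apply/eqP; rewrite -[_ == _]negbK -has_filter -all_predC.
  by apply: sub_all (is_partition_all_head _ _ ps) => p /=; lia.
rewrite /=; have -> : x = 1 by lia.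
congr (_ :: _); apply/esym/all_pred1P/allP => p sp.
move: (ps); rewrite /is_partition => /andP[_ /= /andP[_ /allP /(_ _ sp)]].
by have /allP/(_ _ sp) := is_partition_all_head _ _ ps; rewrite /=; lia.
Qed.

(** Positive parts exceed 1 once raised, so the filter discards exactly the padding, whatever its
    length. *)
Lemma shrink_sylvester_tail (s : seq nat) (k : nat) : is_partition s ->
  shrink ([seq p.+1 | p <- s] ++ nseq k 1) = s.
Proof.
move=> /andP[_ pos]; rewrite /shrink filter_cat map_cat.
have -> : [seq p <- nseq k 1 | 1 < p] = [::] by elim: k.
rewrite cats0; elim: s pos => //= x s IH /andP[x0 /IH].
by rewrite ltnS x0 /= => ->.
Qed.

Lemma is_partition_shrink (s : seq nat) :
  is_partition s -> is_partition (shrink s).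
Proof.
rewrite !is_partition_pairwise /shrink => /andP[pw _]; apply/andP; split.
  rewrite pairwise_map; apply: sub_pairwise (pairwise_filter _ pw) => a b /=; lia.
by rewrite all_map; apply/allP => p; rewrite mem_filter /= => /andP[]; lia.
Qed.

Lemma size_shrink (s : seq nat) : size (shrink s) <= size s.
Proof. by rewrite size_map size_filter count_size. Qed.

(** The invariant forces the first part. The front of the image gives [gamma] of the remaining
    parts, [shrink] of its tail gives their image, and [y] then follows from [gamma]. *)
Lemma sylvester_inj (s t : seq nat) :
  is_strict_partition s -> is_strict_partition t ->
  gamma s = gamma t -> sylvester s = sylvester t -> s = t.
Proof.
move=> ss st eg es.
have eh : head 0 s = head 0 t by rewrite -!size_sylvester // eg es.
elim/seq_pair_ind: s t ss st eg es eh => [|x|x y s IH] [|x' [|y' t]];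
  rewrite ?is_strict_partition_cons //=; try by lia.
  by move=> _ _ ->.
move=> /and3P[yx sy ss] /and3P[yx' ty st] eg [egt es] eh.
have ey : y = y' by lia.
have est : sylvester s = sylvester t.
  rewrite -(shrink_sylvester_tail (sylvester s)
              (y - (gamma s).+1 - size (sylvester s))); last exact: is_partition_sylvester.
  by rewrite es shrink_sylvester_tail //; exact: is_partition_sylvester.
by rewrite eh ey (IH t) // -!size_sylvester // egt est.
Qed.

Lemma sylvester_surj (j : nat) (u : seq nat) :
  is_partition u -> all (geq j) u ->
  exists s, [/\ is_strict_partition s, gamma s = j & sylvester s = u].
Proof.
(* Induction on a bound for the length, since removing the hook passes from [a :: t] to [shrink t],
   not to [t]. *)
have [m] := ubnP (size u); elim: m j u => // m IH j [|a t] /= szu pu.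
  by case: j => [|j] _; [exists [::] | exists [:: j.+1]].
move=> /andP[aj _]; have := pu; rewrite is_partition_cons => /and3P[a0 _ pt].
have bt : all (geq a.-1) (shrink t).
  rewrite all_map; apply/allP => p; rewrite mem_filter => /andP[_ tp] /=.
  by have /allP/(_ _ tp) := is_partition_all_head _ _ pu; rewrite /=; lia.
have szt := size_shrink t.
have [|r [sr gr er]] := IH a.-1 (shrink t) _ (is_partition_shrink _ pt) bt; first lia.
(* The hook of [a :: t] has [a + size t] cells, and the invariant makes the first part [j] plus the
   length of [a :: t]. *)
exists [:: (j + size t).+1, a + size t & r]; split.
- rewrite !is_strict_partition_cons /= sr -size_sylvester // gr er; lia.
- by rewrite /= gr; lia.
- rewrite /= gr er prednK // addnC addnK.
  by rewrite shrinkK.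
Qed.

(** Positive parts with sum [n] number at most [n], so all these sequences come from one finite type
    of tuples. *)
Lemma finite_bounded_partitions (n j : nat) : finite_set (bounded_partitions n j).
Proof.
pose F := {k : 'I_n.+1 & k.-tuple 'I_j.+1}.
pose f (x : F) : seq nat := [seq val i | i <- tagged x].
apply: (@sub_finite_set _ _ (f @` setT)%classic); last first.
  exact/finite_image/finite_finset.
move=> s [/andP[_ pos] sn bd] /=.
have szs : size s < n.+1.
  by rewrite ltnS -sn; elim: s pos {sn bd} => //= x s IH /andP[x0 /IH]; lia.
have sz : size [seq inord i : 'I_j.+1 | i <- s] == Ordinal szs by rewrite size_map.
exists (Tagged (fun k : 'I_n.+1 => k.-tuple 'I_j.+1) (Tuple sz)) => //.
rewrite /f /= -map_comp -[RHS]map_id; apply/eq_in_map => i si /=.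
by rewrite inordK // ltnS; move/allP: bd; apply.
Qed.

Lemma distinct_partitionsP (n j : nat) (s : seq nat) :
  distinct_partitions n j s <->
  [/\ is_strict_partition s, even_index_sum s = n & gamma s = j].
Proof.
rewrite is_strict_partitionE; split=> [[ps us en aj]|[/andP[ps us] en gj]]; split => //.
- by rewrite ps.
- by move: aj; rewrite alternating_sumE; [case | case/andP: ps].
- by rewrite alternating_sumE ?gj //; case/andP: ps.
Qed.

Lemma sylvester_image (n j : nat) :
  (sylvester @` distinct_partitions n j = bounded_partitions n j)%classic.
Proof.
apply/seteqP; split=> [_ [s /distinct_partitionsP[ss en gj] <-]|u [pu un bu]].
  split; [exact: is_partition_sylvester | by rewrite sumn_sylvester |].
  by rewrite -gj; exact: sylvester_le_gamma.
have [s [ss gj eu]] := sylvester_surj j u pu bu.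
exists s => //; apply/distinct_partitionsP; split => //.
by rewrite -sumn_sylvester // eu.
Qed.

Theorem theorem1p4 (n j : nat) :
  [/\ finite_set (distinct_partitions n j),
      finite_set (bounded_partitions n j) &
      #|` fset_set (distinct_partitions n j)|%fset
      = #|` fset_set (bounded_partitions n j)|%fset].
Proof.
have ceq : (bounded_partitions n j #= distinct_partitions n j)%card.
  (* Injectivity holds on this set because [gamma] is constantly [j] there. *)
  rewrite -sylvester_image; apply: inj_card_eq => s t.
  rewrite !inE => /distinct_partitionsP[ss _ gs] /distinct_partitionsP[st _ gt].
  by apply: sylvester_inj; rewrite ?gs.
have fb := finite_bounded_partitions n j.
have fd : finite_set (distinct_partitions n j) by rewrite -(eq_finite_set ceq).
by split => //; apply/esym/fcard_eq.
Qed.
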